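(* Let $p_1$ be an odd prime, $m\ge 1$ an integer and $N=p_1^m$. Let $p$ be a prime with $\gcd(p(p-1),N)=1$, let $f=\mathrm{ord}_N(p)$ be the multiplicative order of $p$ modulo $N$, let $q=p^f$, and let $w=[(\mathbb{Z}/N\mathbb{Z})^*:\langle p\rangle]=\phi(N)/f$. Assume that $-1\notin\langle p\rangle$ in $(\mathbb{Z}/N\mathbb{Z})^*$ and that $w\mid (p_1-1)$. Let $\gamma$ be a fixed primitive element of $\mathbb{F}_q$, let $C_i=\{\gamma^{i+jN}\mid 0\le j\le \frac{q-1}{N}-1\}$ for $0\le i\le N-1$, and let $$D=\bigcup_{i=0}^{p_1^{m-1}-1} C_i .$$ Then the Cayley graph $\mathrm{Cay}(\mathbb{F}_q,D)$ is an undirected regular graph of valency $|D|$, and it has at most $w+1$ distinct restricted eigenvalues.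
   Context: $\phi$ denotes the Euler totient function and $\langle p\rangle$ denotes the cyclic subgroup of $(\mathbb{Z}/N\mathbb{Z})^*$ generated by $p$. For a subset $D\subseteq\mathbb{F}_q^*$, $\mathrm{Cay}(\mathbb{F}_q,D)$ is the graph with vertex set $\mathbb{F}_q$ in which two vertices are adjacent if and only if their difference belongs to $D$ (it is undirected when $-D=D$). The eigenvalues of a graph are the eigenvalues of its adjacency matrix; an eigenvalue is called restricted if it has an eigenvector orthogonal to the all-one vector. *)

(* Defs.v *)
From HB Require Import structures.
From mathcomp Require Import all_boot all_order all_fingroup all_algebra.
Set Implicit Arguments.
Unset Strict Implicit.
Unset Printing Implicit Defensive.
Import GRing.Theory.
Local Open Scope ring_scope.

Definition cayley (V : finZmodType) (D : {set V}) : rel V :=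
  fun x y => x - y \in D.

Definition undirected (T : finType) (e : rel T) : Prop :=
  symmetric e /\ irreflexive e.

Definition regular_of_valency (T : finType) (e : rel T) (k : nat) : Prop :=
  forall x : T, #|[set y | e x y]| = k.

(* Vertices are numbered by enum_val; another numbering conjugates the matrix
   by a permutation matrix, which fixes the all-one vector. *)
Definition adjacency_mx (C : numClosedFieldType) (T : finType) (e : rel T) :
    'M[C]_#|T| :=
  \matrix_(i, j) (e (enum_val i) (enum_val j))%:R.

(* Eigenvectors are row vectors, as in mxalgebra; the adjacency matrix of an
   undirected graph is symmetric, so the side does not matter.  The all-one
   vector is real, so no conjugation is needed in the inner product. *)
Definition restricted_eigenvalue (C : numClosedFieldType) (T : finType)
    (e : rel T) (a : C) : Prop :=
  exists v : 'rV[C]_#|T|,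
    [/\ v != 0, (v <= eigenspace (adjacency_mx C e) a)%MS
      & v *m (const_mx 1 : 'cV[C]_#|T|) = 0].

Definition cyclotomic_class (F : finFieldType) (gamma : F) (N i : nat) :
    {set F} :=
  [set gamma ^+ (i + j * N) | j : 'I_(#|F|.-1 %/ N)].

Definition cyclotomic_union (F : finFieldType) (gamma : F) (N k : nat) :
    {set F} :=
  \bigcup_(i < k) cyclotomic_class gamma N i.

(* Main.v *)
Require Import Defs.
From HB Require Import structures.
From mathcomp Require Import all_boot all_order all_fingroup all_algebra.
From mathcomp Require Import cyclic finfield.
Set Implicit Arguments.
Unset Strict Implicit.
Unset Printing Implicit Defensive.
Import GRing.Theory.
Local Open Scope ring_scope.

(** Let [psi] be a nontrivial additive character of [F] with [psi (x ^ p) = psi x],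
    and let [eta a] be its sum over the cyclotomic class [C_a].  By Fourier inversion
    every restricted eigenvalue is [\sum_(i < M) eta (a + i)] for some [a], where
    [M = p1 ^ (m - 1)].  The function [eta] is [N]-periodic and invariant under
    multiplication by [p].  Since the index [w] is prime to [p1], the subgroup [<p>]
    contains every residue that is [1] modulo [p1]; hence [eta (a + M) = eta a] unless
    [M] divides [a].  So moving the window by one step changes its sum only when [M]
    divides its starting point, and all sums have the form [eta (M * b) + const],
    which depends only on the orbit of [b] modulo [p1] under [<p>]: there are [w]
    orbits of units and the orbit of [0]. *)

(** * Additive characters of a finite field *)

Lemma eqr_nat_pchar (R : nzRingType) (p n k : nat) :
  p \in [pchar R] -> ((n%:R : R) == k%:R) = (n == k %[mod p]).
Proof.
move=> pchR; wlog le_kn : n k / (k <= n)%N.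
  move=> IH; case/orP: (leq_total k n) => le; first exact: IH.
  by rewrite eq_sym IH // eq_sym.
by rewrite eqn_mod_dvd // (dvdn_pcharf pchR) natrB // subr_eq0.
Qed.

(** A root of [1 + X + ... + X^(p-1)] has order dividing [p]; order 1 would give [p = 0], impossible
    in characteristic zero. *)
Lemma closed_prime_root (C : numClosedFieldType) (p : nat) :
  prime p -> exists z : C, p.-primitive_root z.
Proof.
move=> p_pr; have p_gt1 := prime_gt1 p_pr.
have /closed_rootP[z /rootP z_root] : size (\poly_(i < p) (1 : C)) != 1%N.
  by rewrite size_poly_eq ?oner_eq0 // neq_ltn p_gt1 orbT.
have sum0 : \sum_(i < p) z ^+ i = 0.
  by move: z_root; rewrite horner_poly; under eq_bigr do rewrite mul1r.
have zp1 : z ^+ p = 1 by apply/eqP; rewrite -subr_eq0 subrX1 sum0 mulr0.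
have [k k_prim k_dvd] := prim_order_exists (prime_gt0 p_pr) zp1.
case/primeP: p_pr => _ /(_ k k_dvd)/orP[]/eqP k_def; last by exists z; rewrite -k_def.
move: sum0; rewrite -(expr1 z) -k_def (prim_expr_order k_prim).
under eq_bigr do rewrite expr1n.
by rewrite sumr_const card_ord => /eqP; rewrite Num.Theory.pnatr_eq0 -leqn0 leqNgt ltnW.
Qed.

(** [X^p - X] already has the [p] distinct roots [0, ..., p-1], so a further root would exceed its
    degree. *)
Lemma fixed_frobenius_nat (R : idomainType) (p : nat) (y : R) :
  p \in [pchar R] -> y ^+ p = y -> exists n : nat, y = n%:R.
Proof.
move=> pchR yp; have p_pr := pcharf_prime pchR; have p_gt1 := prime_gt1 p_pr.
pose rs := [seq (i%:R : R) | i <- iota 0 p].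
have [/mapP[i _ ->]|y_nrs] := boolP (y \in rs); first by exists i.
have szP : size ('X^p - 'X : {poly R}) = p.+1.
  by rewrite size_polyDl ?size_polyXn // size_polyN size_polyX.
have P0 : ('X^p - 'X : {poly R}) != 0 by rewrite -size_poly_eq0 szP.
have rootsP : all (root ('X^p - 'X)) (y :: rs).
  rewrite /= rootE !hornerE yp subrr eqxx /=; apply/allP => _ /mapP[i _ ->].
  by rewrite rootE !hornerE -[i%:R ^+ p](pFrobenius_autE pchR) rmorph_nat subrr.
have uniq_rs : uniq (y :: rs).
  rewrite /= y_nrs map_inj_in_uniq ?iota_uniq // => i j.
  rewrite !mem_iota !add0n => /andP[_ lti] /andP[_ ltj] /eqP.
  by rewrite (eqr_nat_pchar _ _ pchR) !modn_small // => /eqP.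
by have := max_poly_roots P0 rootsP uniq_rs; rewrite /= size_map size_iota szP ltnn.
Qed.

Lemma frobenius_invariant_character (C : numClosedFieldType) (F : finFieldType)
    (p f : nat) : prime p -> #|F| = (p ^ f)%N ->
  exists psi : F -> C,
    [/\ psi 0 = 1, {morph psi : x y / x + y >-> x * y},
        forall x, psi (x ^+ p) = psi x & exists x, psi x != 1].
Proof.
move=> p_pr cardF; have p_gt0 := prime_gt0 p_pr.
have pchF : p \in [pchar F].
  by have := card_finPcharP cardF p_pr.
have f_gt0 : (0 < f)%N.
  by case: f cardF => // cF; have := finNzRing_gt1 F; rewrite cF.
(* [tr] is the absolute trace. Its values lie in the prime field, and [psi x] will be [z] to the
   power [tr x], for a primitive [p]-th root of unity [z]. *)
pose tr (x : F) := \sum_(i < f) x ^+ (p ^ i).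
have trD x y : tr (x + y) = tr x + tr y.
  rewrite -big_split; apply: eq_bigr => i _; rewrite exprDn_pchar //.
  by rewrite (eq_pnat _ (pcharf_eq pchF)) pnatX pnat_id.
have tr_frob x : tr (x ^+ p) = tr x.
  (* The [p]-th power shifts the summands cyclically; the last one wraps around because
     [x ^+ #|F| = x]. *)
  rewrite /tr -(prednK f_gt0) big_ord_recr [RHS]big_ord_recl /= addrC.
  congr (_ + _).
    by rewrite -exprM -expnS prednK // -cardF expf_card.
  by apply: eq_bigr => i _; rewrite -exprM -expnS.
have trp x : tr x ^+ p = tr x.
  rewrite -[RHS]tr_frob -[LHS](pFrobenius_autE pchF) rmorph_sum.
  by apply: eq_bigr => i _; rewrite /= pFrobenius_autE -!exprM mulnC.
have [|g gP] := @fin_all_exists F _ (fun x n => tr x = n%:R).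
  by move=> x; apply: fixed_frobenius_nat pchF (trp x).
have [z z_prim] := closed_prime_root C p_pr.
have zg x n : tr x = n%:R -> z ^+ g x = z ^+ n.
  rewrite gP => /eqP; rewrite (eqr_nat_pchar _ _ pchF) -(eq_prim_root_expr z_prim).
  by move=> /eqP.
exists (fun x => z ^+ g x); split.
- rewrite (@zg 0 0%N) // /tr big1 // => i _.
  by rewrite expr0n expn_eq0 eqn0Ngt p_gt0.
- by move=> x y; rewrite -exprD; apply: zg; rewrite trD !gP natrD.
- by move=> x; apply: zg; rewrite tr_frob gP.
have [/existsP[x]|/existsPn tr0] := boolP [exists x, tr x != 0].
  rewrite gP -(dvdn_pcharf pchF) => nd; exists x.
  by rewrite -(prim_order_dvd z_prim).
have tr0' x : tr x = 0 by apply/eqP/negPn/tr0.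
(* The trace polynomial has degree [p ^ f.-1], too small to vanish on all [p ^ f] elements. *)
pose P : {poly F} := \sum_(i < f) 'X^(p ^ i).
have szP : size P = (p ^ f.-1).+1.
  rewrite /P -(prednK f_gt0) big_ord_recr /= addrC size_polyDl ?size_polyXn //.
  rewrite ltnS (leq_trans (size_sum _ _ _)) //; apply/bigmax_leqP => i _.
  by rewrite size_polyXn ltn_exp2l ?prime_gt1.
have P0 : P != 0 by rewrite -size_poly_eq0 szP.
have rootsP : all (root P) (enum F).
  apply/allP => x _; rewrite rootE horner_sum.
  by under eq_bigr do rewrite hornerXn; rewrite -/(tr x) tr0'.
have := max_poly_roots P0 rootsP (enum_uniq _).
by rewrite -cardE cardF szP ltnS leq_exp2l ?prime_gt1 // -ltnS prednK ?ltnn.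
Qed.

(** * Fourier analysis and restricted eigenvalues *)

Lemma character_sum0 (R : idomainType) (F : finFieldType) (psi : F -> R) (y : F) :
  {morph psi : x y / x + y >-> x * y} -> (exists x, psi x != 1) -> y != 0 ->
  \sum_c psi (c * y) = 0.
Proof.
move=> psiD [x psix] y0; apply/eqP.
(* Translating [c] by [x / y] permutes the terms but multiplies the sum by [psi x], which is not
   1. *)
have : \sum_c psi (c * y) * (psi x - 1) == 0.
  rewrite -mulr_suml mulrBr mulr1 subr_eq0 [X in _ == X](reindex_inj (addIr (x / y))) /=.
  rewrite mulr_suml; apply/eqP/eq_bigr => c _.
  by rewrite mulrDl divfK // psiD.
by rewrite -mulr_suml mulf_eq0 subr_eq0 (negPf psix) orbF.
Qed.

(** The Fourier transform [h] of an eigenvector turns adjacency into multiplication by character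
    sums, so [a] is read off wherever [h] is nonzero. Orthogonality to the all-one vector says
    [h 0 = 0], which excludes the zero frequency. *)
Lemma cayley_restricted_eigenvalue (C : numClosedFieldType) (F : finFieldType)
    (D : {set F}) (psi : F -> C) (a : C) :
  psi 0 = 1 -> {morph psi : x y / x + y >-> x * y} -> (exists x, psi x != 1) ->
  restricted_eigenvalue (cayley D) a ->
  exists2 c, c != 0 & a = \sum_(d in D) psi (c * d).
Proof.
move=> psi0 psiD psiN [v [v0 /eigenspaceP vA v1]].
pose g x := v 0 (enum_rank x); pose h c := \sum_x g x * psi (c * x).
have reindexF (G : 'I_#|F| -> C) : \sum_i G i = \sum_x G (enum_rank x).
  exact/reindex/onW_bij/enum_rank_bij.
have gA y : a * g y = \sum_(x | x - y \in D) g x.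
  have := congr1 (fun B : 'rV_ _ => B 0 (enum_rank y)) vA; rewrite !mxE => <-.
  rewrite reindexF [RHS]big_mkcond; apply: eq_bigr => x _.
  rewrite mxE !enum_rankK /cayley.
  by case: (_ \in D); rewrite ?mulr1 ?mulr0.
have ah c : a * h c = h c * \sum_(d in D) psi (- c * d).
  rewrite mulr_sumr mulr_suml.
  transitivity (\sum_y \sum_(x | x - y \in D) g x * psi (c * y)).
    by apply: eq_bigr => y _; rewrite mulrA gA mulr_suml.
  rewrite (exchange_big_dep predT) //=; apply: eq_bigr => x _.
  rewrite (reindex_inj (inv_inj (subKr x))) /= mulr_sumr.
  apply: eq_big => [d|d _]; first by rewrite subKr.
  by rewrite -mulrA -psiD mulrBr mulNr.
have [c hc] : exists c, h c != 0.
  (* Fourier inversion: [\sum_c h c * psi (- (c * y))] equals [#|F|] times [g y], so [h = 0] would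
     force [v = 0]. *)
  apply/existsP; apply: contraNT v0 => /existsPn h0.
  apply/eqP/rowP => i; rewrite mxE -[i]enum_valK -/(g _); set y := enum_val i.
  have : \sum_c h c * psi (- (c * y)) = 0.
    by apply: big1 => c _; have := h0 c; rewrite negbK => /eqP ->; rewrite mul0r.
  under eq_bigr do rewrite mulr_suml.
  rewrite exchange_big /= (bigD1 y) //= addrC big1 ?add0r => [|x xy].
    under eq_bigr do rewrite -mulrA -psiD subrr psi0 mulr1.
    move/eqP; rewrite sumr_const -mulr_natr mulf_eq0 Num.Theory.pnatr_eq0.
    by rewrite -leqn0 leqNgt (ltnW (finNzRing_gt1 F)) orbF => /eqP.
  under eq_bigr do rewrite -mulrA -psiD -mulrBr.
  by rewrite -mulr_sumr character_sum0 ?mulr0 // subr_eq0.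
exists (- c); last by apply: (mulfI hc); rewrite -ah mulrC.
apply: contraNneq hc => /eqP; rewrite oppr_eq0 => /eqP ->.
have := congr1 (fun B : 'M_(1, 1) => B 0 0) v1; rewrite !mxE reindexF => {1}<-.
by apply/eqP/eq_bigr => x _; rewrite mul0r psi0 mxE.
Qed.

(** * Cyclotomic classes *)

Section CyclotomicClasses.
Variables (F : finFieldType) (gamma : F) (N : nat).
Hypotheses (gamma_prim : #|F|.-1.-primitive_root gamma) (N_dvd : (N %| #|F|.-1)%N).

Let K := (#|F|.-1 %/ N)%N.

Let cardF_gt1 : (0 < #|F|.-1)%N.
Proof. by rewrite -ltnS (ltn_predK (finNzRing_gt1 F)) finNzRing_gt1. Qed.

Let N_gt0 : (0 < N)%N. Proof. exact: dvdn_gt0 N_dvd. Qed.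

Let K_gt0 : (0 < K)%N. Proof. by rewrite divn_gt0 // dvdn_leq. Qed.

Let KN : (K * N)%N = #|F|.-1. Proof. exact: divnK. Qed.

Let K_dvd : (K %| #|F|.-1)%N. Proof. exact: dvdn_div. Qed.

Lemma primitive_root_neq0 : gamma != 0.
Proof.
apply: contra_eq_neq (prim_expr_order gamma_prim) => ->.
by rewrite expr0n eqn0Ngt cardF_gt1 eq_sym oner_eq0.
Qed.

Lemma primitive_root_exp (x : F) : x != 0 -> exists n : nat, x = gamma ^+ n.
Proof.
move=> x0; have [|i ->] := prim_rootP gamma_prim (x := x); last by exists i.
by apply: (mulfI x0); rewrite -exprS mulr1 (ltn_predK (finNzRing_gt1 F)) expf_card.
Qed.

(** The classes are cosets of the group of nonzero [N]-th powers, which are the [K]-th roots of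
    unity. Membership becomes an equation between [K]-th powers, on which shift, period, Frobenius
    and sign are direct computations. *)
Lemma mem_cyclotomic_class i x :
  (x \in cyclotomic_class gamma N i) = (x ^+ K == gamma ^+ (i * K)).
Proof.
apply/imsetP/eqP => [[j _ ->]|xK].
  rewrite -exprM mulnDl exprD -mulnA [(N * K)%N]mulnC KN mulnC.
  by rewrite [(j * _)%N]mulnC [X in _ * X]exprM (prim_expr_order gamma_prim) expr1n mulr1 mulnC.
have x0 : x != 0.
  apply: contraTneq (expf_neq0 (i * K) primitive_root_neq0) => x0.
  by rewrite -xK x0 expr0n eqn0Ngt K_gt0 /= eqxx.
have gi0 : gamma ^+ i != 0 by rewrite expf_neq0 ?primitive_root_neq0.
(* The quotient is a [K]-th root of unity, hence a power of [gamma ^+ (#|F|.-1 %/ K)], which is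
   [gamma ^+ N]. *)
have [|j xj] := prim_rootP (dvdn_prim_root gamma_prim K_dvd) (x := x / gamma ^+ i).
  by rewrite exprMn exprVn -exprM xK divff // exprM expf_neq0.
exists j => //; rewrite exprD mulnC exprM -[gamma ^+ N in RHS](_ : gamma ^+ (#|F|.-1 %/ K) = _).
  by rewrite -xj mulrC divfK.
by rewrite -KN mulKn.
Qed.

Lemma mem_cyclotomic_class_shift a i x :
  (gamma ^+ a * x \in cyclotomic_class gamma N (a + i)) =
    (x \in cyclotomic_class gamma N i).
Proof.
rewrite !mem_cyclotomic_class exprMn -exprM mulnDl exprD.
by rewrite (inj_eq (mulfI _)) // expf_neq0 ?primitive_root_neq0.
Qed.

Lemma cyclotomic_class_period i :
  cyclotomic_class gamma N (i + N) = cyclotomic_class gamma N i.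
Proof.
apply/setP => x; rewrite !mem_cyclotomic_class mulnDl exprD [(N * K)%N]mulnC KN.
by rewrite (prim_expr_order gamma_prim) mulr1.
Qed.

Lemma mem_cyclotomic_class_frobenius p i x : p \in [pchar F] ->
  (x ^+ p \in cyclotomic_class gamma N (p * i)) =
    (x \in cyclotomic_class gamma N i).
Proof.
move=> pchF; rewrite !mem_cyclotomic_class -mulnA -exprM mulnC exprM.
rewrite [(p * _)%N]mulnC [X in _ == X]exprM -!(pFrobenius_autE pchF).
exact/inj_eq/fmorph_inj.
Qed.

Lemma cyclotomic_class0 i : 0 \notin cyclotomic_class gamma N i.
Proof.
rewrite mem_cyclotomic_class expr0n eqn0Ngt K_gt0 eq_sym.
by rewrite expf_neq0 ?primitive_root_neq0.
Qed.

Lemma cyclotomic_classN i x : odd N ->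
  (- x \in cyclotomic_class gamma N i) = (x \in cyclotomic_class gamma N i).
Proof.
move=> oddN; rewrite !mem_cyclotomic_class; congr (_ == _).
suff: (-1) ^+ K = 1 :> F by move=> signK; rewrite exprNn signK mul1r.
(* As [N] is odd, [K] and [#|F|.-1] have the same parity. *)
have -> : (-1) ^+ K = (-1) ^+ #|F|.-1 :> F.
  by rewrite -KN -[LHS]signr_odd -[RHS]signr_odd oddM oddN andbT.
have N1 : -1 != 0 :> F by rewrite oppr_eq0 oner_eq0.
by apply: (mulfI N1); rewrite -exprS mulr1 (ltn_predK (finNzRing_gt1 F)) expf_card.
Qed.

Lemma disjoint_cyclotomic_classes i j : (i < N)%N -> (j < N)%N -> i != j ->
  [disjoint cyclotomic_class gamma N i & cyclotomic_class gamma N j].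
Proof.
move=> ltiN ltjN; apply: contraNT => /pred0Pn[x /andP[/=]].
rewrite !mem_cyclotomic_class => /eqP ->.
rewrite (eq_prim_root_expr gamma_prim) -KN mulnC [(j * K)%N]mulnC.
by rewrite -!muln_modr eqn_pmul2l // !modn_small.
Qed.

Lemma sum_cyclotomic_union (V : nmodType) (k : nat) (G : F -> V) : (k <= N)%N ->
  \sum_(x in cyclotomic_union gamma N k) G x =
    \sum_(i < k) \sum_(x in cyclotomic_class gamma N i) G x.
Proof.
move=> leqkN; rewrite partition_disjoint_bigcup // => i j neq_ij.
by apply: disjoint_cyclotomic_classes; rewrite ?(leq_trans (ltn_ord _)).
Qed.

End CyclotomicClasses.

(** * Residues congruent to 1 modulo a prime *)

Lemma expn_prime_power_1mod (p n x : nat) :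
  prime p -> x = 1 %[mod p] -> (x ^ (p ^ n) = 1 %[mod p ^ n.+1])%N.
Proof.
move=> p_pr x1; elim: n => [|n IHn]; first by rewrite expn0 !expn1.
have x_gt0 : (0 < x)%N.
  by case: x x1 {IHn} => // /eqP; rewrite mod0n modn_small ?prime_gt1.
rewrite expnSr expnM; set y := (x ^ (p ^ n))%N in IHn *.
have y_gt0 : (0 < y)%N by rewrite expn_gt0 x_gt0.
have y1 : y = 1 %[mod p].
  by rewrite -(modn_dvdm y (dvdn_exp2l p (ltn0Sn n))) IHn expn1 modn_dvdm // dvdn_exp.
(* [y ^ p - 1] is [y - 1] times a sum of [p] terms, each 1 modulo [p]; this sum supplies the extra
   factor [p]. *)
apply/eqP; rewrite eqn_mod_dvd ?expn_gt0 ?x_gt0 // -[X in (_ - X)%N](exp1n p).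
rewrite subn_exp expnSr dvdn_mul //.
  by rewrite -eqn_mod_dvd // IHn.
rewrite /dvdn -modn_summ (eq_bigr (fun=> (1 %% p)%N)) => [|i _].
  by rewrite modn_summ sum1_card card_ord modnn.
by rewrite exp1n muln1 -modnXm y1 modnXm exp1n.
Qed.

(** The image of [g] in the quotient by [<[x]>] has order dividing both [#[g]] and the index, so it
    is trivial. *)
Lemma coprime_index_mem_cycle (gT : finGroupType) (G : {group gT}) (x g : gT) :
  abelian G -> x \in G -> g \in G -> coprime #[g]%g #|G : <[x]>|%g ->
  g \in <[x]>%g.
Proof.
move=> abG Gx Gg cop; have xG : <[x]>%g \subset G by rewrite cycle_subG.
have nxG : G \subset 'N(<[x]>)%g by apply: sub_abelian_norm.
have nxg := subsetP nxG _ Gg.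
apply: coset_idr => //; apply/eqP; rewrite -order_eq1 -dvdn1 -(eqP cop) dvdn_gcd.
rewrite morph_order //= -card_quotient // order_dvdG //.
exact: mem_quotient.
Qed.

(** The unit [k] has order dividing [p1 ^ m.-1], which is prime to the index of [<[u]>], a divisor
    of [p1 - 1]; hence it is a power of [u]. *)
Lemma one_mod_prime_power_residue (p1 m p k : nat) (u : {unit 'Z_(p1 ^ m)}) :
  prime p1 -> (0 < m)%N -> FinRing.uval u = p%:R ->
  (#|units_Zp (p1 ^ m) : <[u]>|%g %| p1 - 1)%N -> k = 1 %[mod p1] ->
  exists j, k = p ^ j %[mod p1 ^ m].
Proof.
move=> p1_pr m_gt0 u_def w_dvd k1; set N := (p1 ^ m)%N in u u_def w_dvd *.
have N_gt1 : (1 < N)%N by rewrite -(exp1n m) ltn_exp2r ?prime_gt1.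
have Uk : (k%:R : 'Z_N) \is a GRing.unit.
  by rewrite unitZpE // coprimeXl // coprime_sym -coprime_modl k1 coprime_modl coprime1n.
pose g := FinRing.unit _ Uk.
have g_ord : (#[g]%g %| p1 ^ m.-1)%N.
  rewrite order_dvdn; apply/eqP/val_inj; rewrite /= FinRing.val_unitX /=.
  have kN := expn_prime_power_1mod m.-1 p1_pr k1; rewrite prednK // -/N in kN.
  by rewrite -natrX -Zp_nat_mod // kN Zp_nat_mod.
have /cycleP[j gj] : g \in <[u]>%g.
  apply: (@coprime_index_mem_cycle _ (units_Zp_group N)).
  - exact: units_Zp_abelian.
  - exact: in_setT.
  - exact: in_setT.
  apply: coprime_dvdl g_ord _; rewrite coprimeXl // (coprime_dvdr w_dvd) //.
  by rewrite subn1 coprimenP ?prime_gt0.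
exists j; have := congr1 (fun v => nat_of_ord (FinRing.uval v)) gj.
by rewrite FinRing.val_unitX /= u_def -natrX !val_Zp_nat.
Qed.

(** * Window sums of a periodic function *)

Section PeriodWindows.
Variables (V : zmodType) (p1 m p : nat) (u : {unit 'Z_(p1 ^ m)}) (eta : nat -> V).
Hypotheses (p1_pr : prime p1) (m_gt0 : (0 < m)%N) (u_def : FinRing.uval u = p%:R).
Hypothesis w_dvd : (#|units_Zp (p1 ^ m) : <[u]>|%g %| p1 - 1)%N.
Hypotheses (eta_period : forall a, eta (a + p1 ^ m) = eta a)
           (eta_mulp : forall a, eta (p * a) = eta a).

Let M := (p1 ^ m.-1)%N.

Let M_gt0 : (0 < M)%N. Proof. by rewrite expn_gt0 prime_gt0. Qed.

Let p1M : (p1 * M)%N = (p1 ^ m)%N. Proof. by rewrite -expnS prednK. Qed.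

Let N_gt1 : (1 < p1 ^ m)%N.
Proof. by rewrite -(exp1n m) ltn_exp2r ?prime_gt1. Qed.

Lemma eta_modn a b : a = b %[mod p1 ^ m] -> eta a = eta b.
Proof.
have eta_mod c : eta c = eta (c %% p1 ^ m)%N.
  rewrite {1}(divn_eq c (p1 ^ m)); elim: (c %/ _)%N => // k IHk.
  by rewrite mulSn -addnA addnC eta_period.
by move=> ab; rewrite eta_mod ab -eta_mod.
Qed.

Lemma eta_mul_expp j a : eta (p ^ j * a) = eta a.
Proof. by elim: j => [|j IHj]; rewrite ?mul1n // expnS -mulnA eta_mulp. Qed.

(* If M does not divide a, then gcd(p1 a, N) divides M, so a + M t = (1 + p1 b) a
   modulo N for some b, and 1 + p1 b lies in <p>. *)
Lemma eta_shift a t : ~~ (M %| a)%N -> eta (a + M * t) = eta a.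
Proof.
move=> Mna.
have [b bP] : exists b, (p1 * a * b = M * t %[mod p1 ^ m])%N.
  have a_gt0 : (0 < p1 * a)%N.
    by rewrite muln_gt0 prime_gt0 // lt0n; apply: contraNneq Mna => ->.
  (* With [gcdn a M = p1 ^ e], this gcd is [p1 ^ e.+1], and [e < m.-1] because [M] does not divide
     [a]. *)
  have g_dvd : (gcdn (p1 * a) (p1 ^ m) %| M)%N.
    rewrite -p1M -muln_gcdr.
    have /(dvdn_pfactor _ _ p1_pr)[e le_e ge] := dvdn_gcdr a M.
    rewrite ge -expnS dvdn_exp2l // ltn_neqAle le_e andbT.
    by apply: contraNneq Mna => e_def; rewrite /M -e_def -ge dvdn_gcdl.
  (* Bezout writes the gcd as a multiple of [p1 * a] modulo [p1 ^ m]; scaling it up to [M * t] gives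
     [b]. *)
  have [r s rs _] := egcdnP (p1 ^ m) a_gt0.
  exists (r * (M %/ gcdn (p1 * a) (p1 ^ m) * t))%N.
  rewrite mulnA [(_ * r)%N]mulnC rs mulnDl [(s * _ * _)%N]mulnAC modnMDl.
  by rewrite mulnA [(gcdn _ _ * _)%N]mulnC divnK.
have [|j jP] := one_mod_prime_power_residue (k := (1 + p1 * b)%N) p1_pr m_gt0 u_def w_dvd.
  by rewrite addnC mulnC modnMDl.
rewrite -[RHS](eta_mul_expp j); apply: eta_modn.
rewrite -[RHS]modnMml -jP modnMml mulnDl mul1n mulnAC.
by rewrite -[LHS]modnDmr -bP modnDmr.
Qed.

Lemma window_sum a :
  exists b, \sum_(i < M) eta (a + i) = eta (M * b) + \sum_(1 <= i < M) eta i.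
Proof.
elim: a => [|a [b IHa]].
  by exists 0%N; rewrite muln0 -(big_mkord xpredT) big_ltn.
(* Both sides are the sum over the window of length [M.+1] starting at [a]. *)
have step : \sum_(i < M) eta (a.+1 + i) + eta a = \sum_(i < M) eta (a + i) + eta (a + M).
  transitivity (\sum_(i < M.+1) eta (a + i)); last by rewrite big_ord_recr.
  rewrite big_ord_recl addn0 addrC; congr (_ + _).
  by apply: eq_bigr => i _; rewrite addSnnS.
have [/dvdnP[c a_def]|Mna] := boolP (M %| a)%N; last first.
  exists b; rewrite -IHa; apply: (addIr (eta a)).
  by rewrite step; congr (_ + _); rewrite -[M]muln1 eta_shift.
exists c.+1.
(* Here [M] divides [a], so [eta (a + i) = eta i] for [0 < i < M]: only the first term of the window
   depends on [a]. *)
have window0 : \sum_(i < M) eta (a + i) = eta a + \sum_(1 <= i < M) eta i.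
  rewrite -(big_mkord xpredT (fun i => eta (a + i))) big_ltn // addn0; congr (_ + _).
  apply: eq_big_nat => i /andP[i_gt0 ltiM].
  rewrite addnC a_def mulnC eta_shift //.
  by rewrite gtnNdvd.
have -> : (M * c.+1 = a + M)%N by rewrite a_def mulnS mulnC addnC.
apply: (addIr (eta a)); rewrite step window0.
by rewrite [LHS]addrC addrA [RHS]addrAC.
Qed.

Lemma window_sum_values : exists s : seq V,
  size s = (#|units_Zp (p1 ^ m) : <[u]>|%g + 1)%N /\
  forall a, \sum_(i < M) eta (a + i) \in s.
Proof.
pose val_of (A : {set {unit 'Z_(p1 ^ m)}}) : nat := FinRing.uval (repr A).
pose c := \sum_(1 <= i < M) eta i.
(* The head serves the [b] divisible by [p1]; the other entries take one representative from each
   coset of [<[u]>]. *)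
exists (eta 0%N + c ::
  [seq eta (M * val_of A) + c | A <- enum (rcosets <[u]> (units_Zp (p1 ^ m)))%g]).
split=> [|a]; first by rewrite /= size_map -cardE addn1.
have [b ->] := window_sum a; rewrite -/c inE.
have [/dvdnP[d ->]|p1nb] := boolP (p1 %| b)%N.
  by rewrite (@eta_modn _ 0%N) ?eqxx // mulnCA mulnC [(M * _)%N]mulnC p1M modnMr mod0n.
apply/orP; right; apply/mapP.
have Ub : (b%:R : 'Z_(p1 ^ m)) \is a GRing.unit.
  by rewrite unitZpE // coprimeXl // prime_coprime.
pose g := FinRing.unit _ Ub.
exists (<[u]> :* g)%g; first by rewrite mem_enum; apply/rcosetsP; exists g; rewrite ?in_setT.
(* The chosen representative is [u ^+ j] times the class of [b], and [eta] absorbs the factor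
   [p ^ j]. *)
congr (_ + _); rewrite /val_of; case: repr_rcosetP => _ /cycleP[j ->].
rewrite FinRing.val_unitM FinRing.val_unitX /= u_def -natrX !val_Zp_nat // Zp_cast // modnMm.
rewrite -[LHS](eta_mul_expp j); apply: eta_modn.
by rewrite modnMmr mulnCA.
Qed.

End PeriodWindows.

(** * The Cayley graph of a union of cyclotomic classes *)

Theorem theorem3p2 (C : numClosedFieldType) (p1 m N p f w : nat)
    (u : {unit 'Z_N}) (F : finFieldType) (gamma : F) (D : {set F})
    (p1_prime : prime p1) (p1_odd : odd p1) (m_ge1 : (1 <= m)%N)
    (N_def : N = (p1 ^ m)%N)
    (p_prime : prime p) (p_coprime : coprime (p * (p - 1)) N)
    (u_def : FinRing.uval u = p%:R)
    (f_def : f = #[u]%g)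
    (w_def : w = #|units_Zp N : <[u]>|%g)
    (N1_notin : (-1 : 'Z_N) \notin [set FinRing.uval v | v in <[u]>%g])
    (w_dvd : (w %| p1 - 1)%N)
    (card_F : #|F| = (p ^ f)%N)
    (gamma_prim : #|F|.-1.-primitive_root gamma)
    (D_def : D = cyclotomic_union gamma N (p1 ^ (m - 1))) :
  [/\ undirected (cayley D),
      regular_of_valency (cayley D) #|D|
    & forall s : seq C,
        uniq s -> (forall a, a \in s -> restricted_eigenvalue (cayley D) a) ->
        (size s <= w + 1)%N].
Proof.
have p1m1 : (p1 ^ (m - 1) = p1 ^ m.-1)%N by rewrite subn1.
subst N w f; rewrite p1m1 in D_def.
have N_gt1 : (1 < p1 ^ m)%N by rewrite -(exp1n m) ltn_exp2r ?prime_gt1.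
have N_odd : odd (p1 ^ m) by rewrite oddX p1_odd orbT.
have le_MN : (p1 ^ m.-1 <= p1 ^ m)%N by rewrite leq_exp2l ?prime_gt1 // leq_pred.
(* [p ^ f] is 1 modulo [N] since [f] is the order of [u]. *)
have N_dvd : (p1 ^ m %| #|F|.-1)%N.
  rewrite card_F -subn1 -eqn_mod_dvd ?expn_gt0 ?prime_gt0 //; apply/eqP.
  have := congr1 (fun v => nat_of_ord (FinRing.uval v)) (expg_order u).
  by rewrite FinRing.val_unitX /= u_def -natrX -[1]/(1%:R) !val_Zp_nat ?Zp_cast.
have memD x : (x \in D) =
    [exists i : 'I_(p1 ^ m.-1), x \in cyclotomic_class gamma (p1 ^ m) i].
  by rewrite D_def; apply/bigcupP/existsP => [[i _]|[i]]; exists i.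
have memDN x : (- x \in D) = (x \in D).
  by rewrite !memD; apply: eq_existsb => i; rewrite cyclotomic_classN.
split.
- split=> [x y|x]; first by rewrite /cayley -opprB memDN.
  rewrite /cayley subrr memD; apply/existsP => -[i].
  by apply/negP/cyclotomic_class0.
(* The map sending [d] to [x - d] is a bijection from [D] onto the neighbours of [x]. *)
- move=> x; rewrite -(card_imset D (inv_inj (subKr x))); apply: eq_card => y.
  rewrite inE; apply/idP/imsetP => [yD|[d dD ->]]; last by rewrite /cayley subKr.
  by exists (x - y); rewrite ?subKr.
move=> s uniq_s eig_s.
have pchF : p \in [pchar F] := card_finPcharP card_F p_prime.
have [psi [psi0 psiD psi_frob psiN]] := frobenius_invariant_character C p_prime card_F.
pose eta a := \sum_(x in cyclotomic_class gamma (p1 ^ m) a) psi x.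
have eta_period a : eta (a + p1 ^ m)%N = eta a by rewrite /eta cyclotomic_class_period.
have frob_inj : injective (fun x : F => x ^+ p).
  by move=> x y; rewrite -!(pFrobenius_autE pchF) => /fmorph_inj.
(* Frobenius carries class [a] onto class [p * a] and preserves [psi]. *)
have eta_mulp a : eta (p * a)%N = eta a.
  rewrite /eta (reindex_inj frob_inj); apply: eq_big => x; last by rewrite psi_frob.
  by rewrite mem_cyclotomic_class_frobenius.
have [t [<- tP]] := window_sum_values p1_prime m_ge1 u_def w_dvd eta_period eta_mulp.
apply: uniq_leq_size => // a /eig_s /(cayley_restricted_eigenvalue psi0 psiD psiN)[c c0 ->].
(* Multiplication by [c = gamma ^+ n] carries class [i] onto class [n + i], so the eigenvalue is the
   window sum starting at [n]. *)
have [n ->] := primitive_root_exp gamma_prim c0.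
have gn0 : gamma ^+ n != 0 by rewrite expf_neq0 ?(primitive_root_neq0 gamma_prim).
rewrite D_def (sum_cyclotomic_union gamma_prim) //.
suff -> : \sum_(i < p1 ^ m.-1) \sum_(x in cyclotomic_class gamma (p1 ^ m) i)
    psi (gamma ^+ n * x) = \sum_(i < p1 ^ m.-1) eta (n + i)%N by [].
apply: eq_bigr => i _; rewrite /eta [RHS](reindex_inj (mulfI gn0)).
by apply: eq_bigl => x; rewrite mem_cyclotomic_class_shift.
Qed.
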